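(* Let $M$ be a Garside monoid with Garside element $\Delta$ and group of fractions $G$, let $a\in G$ and $m\in\mathbb{Z}$. Given $u,v\in C^{\geq m}(a)$, there exists a sequence $u=u_1,u_2,\ldots,u_k=v$ of elements of $C^{\geq m}(a)$ such that, for $i=1,\ldots,k-1$, the elements $u_i$ and $u_{i+1}$ are conjugated by an element of $S_{u_i}^{\geq m}$, that is, $u_{i+1}=s_i^{-1}u_is_i$ for some $s_i\in S_{u_i}^{\geq m}$.
   Context: In a cancellative monoid $M$ with no invertible elements other than $1$, write $a\prec b$ if $ac=b$ for some $c\in M$ ($a$ is a left divisor of $b$) and $b\succ a$ if $b=ca$ for some $c\in M$ ($a$ is a right divisor of $b$). An atom is an element $x\neq 1$ such that $x=yz$ implies $y=1$ or $z=1$. $M$ is atomic if it is generated by its atoms and for every $x\in M$ there is an integer $N_x>0$ such that $x$ is not a product of more than $N_x$ atoms. $M$ is Gaussian if it is atomic, left and right cancellative, and every pair of elements has a (left and right) lcm and a (left and right) gcd. A Garside element is an element $\Delta\in M$ whose left divisors coincide with its right divisors, form a finite set, and generate $M$; a Garside monoid is a Gaussian monoid having a Garside element $\Delta$ (fixed). The divisors of $\Delta$ are the simple elements, and $S$ is the finite set of them. $M$ embeds in its group of fractions $G$ and is regarded as a subset of $G$. For $a\in G$: $\inf(a)=\max\{r\in\mathbb{Z}:\Delta^{-r}a\in M\}$; $C(a)$ is the conjugacy class of $a$ in $G$; $C^{\geq m}(a)=\{v\in C(a):\inf(v)\geq m\}$. For $v\in C^{\geq m}(a)$, a simple element $s$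 satisfies property $\mathcal{P}_v^{\geq m}$ if $s^{-1}vs\in C^{\geq m}(a)$. $S_v^{\geq m}$ is the set of $\prec$-minimal elements among the nontrivial ($\neq 1$) simple elements satisfying $\mathcal{P}_v^{\geq m}$. *)

(* Defs.v *)
From HB Require Import structures.
From mathcomp Require Import all_boot all_order all_algebra.

Set Implicit Arguments.
Unset Strict Implicit.
Unset Printing Implicit Defensive.

Import Algebra.
Local Open Scope group_scope.

Section Monoids.
Variable M : monoidType.
Implicit Types (A : M -> Prop) (le : M -> M -> Prop) (a b c d x y z Delta : M).

(* ldivides a b is a ≺ b; rdivides a b is b ≻ a. *)
Definition ldivides a b : Prop := exists c, a * c = b.
Definition rdivides a b : Prop := exists c, c * a = b.

Definition is_gcd le a b d : Prop :=
  [/\ le d a, le d b & forall c, le c a -> le c b -> le c d].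
Definition is_lcm le a b d : Prop :=
  [/\ le a d, le b d & forall c, le a c -> le b c -> le d c].

Definition generated_by A : Prop :=
  forall x, exists2 s : seq M, forall y, y \in s -> A y & x = \prod_(y <- s) y.

Definition atom x : Prop :=
  x <> 1 /\ forall y z, x = y * z -> y = 1 \/ z = 1.

Definition atomic : Prop :=
  generated_by atom /\
  forall x, exists2 N : nat, (0 < N)%N &
    forall s : seq M, (forall y, y \in s -> atom y) ->
      x = \prod_(y <- s) y -> (size s <= N)%N.

(* The absence of invertible elements other than 1 follows from atomicity; it
   is kept because it is part of the setting in which atoms are defined. *)
Record gaussian : Prop := Gaussian {
  gaussian_cancell : forall a b c, a * b = a * c -> b = c;
  gaussian_cancelr : forall a b c, b * a = c * a -> b = c;
  gaussian_conical : forall x y, x * y = 1 -> y * x = 1 -> x = 1;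
  gaussian_atomic : atomic;
  gaussian_lgcd : forall a b, exists d, is_gcd ldivides a b d;
  gaussian_rgcd : forall a b, exists d, is_gcd rdivides a b d;
  gaussian_llcm : forall a b, exists d, is_lcm ldivides a b d;
  gaussian_rlcm : forall a b, exists d, is_lcm rdivides a b d }.

Record garside_element Delta : Prop := GarsideElement {
  garside_divisors : forall s, ldivides s Delta <-> rdivides s Delta;
  garside_finite : exists l : seq M, forall s, ldivides s Delta -> s \in l;
  garside_generates : generated_by (ldivides^~ Delta) }.

Definition garside_monoid Delta : Prop := gaussian /\ garside_element Delta.

(* For a Garside element, left divisors and right divisors coincide. *)
Definition simple Delta s : Prop := ldivides s Delta.

End Monoids.

Definition expgz (G : groupType) (x : G) (r : int) : G :=
  match r with Posz n => x ^+ n | Negz n => x ^- n.+1 end.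

(* iota identifies M with a submonoid of G, all of whose elements are
   fractions of elements of M. *)
Definition group_of_fractions (M : monoidType) (G : groupType)
    (iota : UMagmaMorphism.type M G) : Prop :=
  injective iota /\ forall g : G, exists x y : M, g = iota x / iota y.

Section Conjugacy.
Variables (M : monoidType) (G : groupType) (iota : UMagmaMorphism.type M G).
Variable Delta : M.
Implicit Types (a v g : G) (r m : int) (s t : M).

Definition in_monoid g : Prop := exists x : M, g = iota x.

(* is_inf a r states that inf(a) = r, i.e. that r is the greatest element of
   the set of r' such that Delta^(-r') a lies in M. *)
Definition is_inf a r : Prop :=
  in_monoid (expgz (iota Delta) (- r)%R * a) /\
  forall r', in_monoid (expgz (iota Delta) (- r')%R * a) -> (r' <= r)%R.

Definition conj_class a v : Prop := exists g, v = a ^ g.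

Definition conj_class_ge a m v : Prop :=
  conj_class a v /\ exists2 r, is_inf v r & (m <= r)%R.

Definition prop_ge a m v s : Prop := conj_class_ge a m (v ^ iota s).

Definition minimal_simple_ge a m v s : Prop :=
  [/\ simple Delta s, s <> 1, prop_ge a m v s &
      forall t, simple Delta t -> t <> 1 -> prop_ge a m v t ->
        ldivides t s -> t = s].

End Conjugacy.

(* Main.v *)
Require Import Defs.
From HB Require Import structures.
From mathcomp Require Import all_boot all_order all_algebra.
From mathcomp Require Import zify.
From Stdlib Require Import Classical.

(** The conjugator can be made positive, and a positive conjugator factors
    greedily into minimal simple elements.

    Let inf(u) >= m.  The condition inf(u ^ x) >= m on an element x of M says
    that Delta^-m x Delta^m left-divides w x, where w = Delta^-m u lies in M ([inf_ge_conj_ldivides]).  Since left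
    multiplication by w commutes with left gcds, the set of such x is closed
    under left gcd ([inf_ge_conj_gcd]).  It also contains Delta, because
    conjugation by Delta preserves M.

    Now let x <> 1 be an element of M that conjugates u to v, both in
    C^{>=m}(a).  The left gcd of x and Delta is a nontrivial simple element with
    the required property, so some minimal one, s, left-divides x.  Replacing
    (u, x) by (u ^ s, s^-1 x) shortens x, and atomicity makes this terminate
    ([positive_conjugator_path]).

    An arbitrary conjugator g = x / y is reduced to a positive one with the help
    of a central power of Delta: conjugation by Delta permutes the finite set of
    simple elements, so some power Delta^e with e > 0 is central
    ([central_Delta_power]).  As y left-divides some power of Delta^e, the
    product of g by that power lies in M and has the same conjugation action.

    One point remains: C^{>=m}(a) is defined through inf, so each new vertex
    must be shown to have one.  If Delta <> 1 then an element of M cannot be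
    divided by arbitrarily high powers of Delta ([inf_exists]); and Delta = 1 is
    excluded because then no element has an inf ([is_inf_Delta_neq1]). *)

Set Implicit Arguments.
Unset Strict Implicit.
Unset Printing Implicit Defensive.

Import Algebra.
Local Open Scope group_scope.

(** * Integer powers in a group and maxima of bounded sets *)

Lemma expgzN (G : groupType) (x : G) (r : int) :
  expgz x (- r)%R = (expgz x r)^-1.
Proof. by case: r => [[|n]|n] /=; rewrite ?invg1 ?invgK. Qed.

Lemma expgz_succ (G : groupType) (x : G) (r : int) :
  expgz x (r + 1)%R = expgz x r * x.
Proof.
case: r => [n|[|n]].
- by rewrite -PoszD addn1 -expgSr.
- by rewrite /= expg1 mulVg.
have -> : (Negz n.+1 + 1 = Negz n)%R by lia.
by rewrite /= [x ^+ n.+2]expgS invgM mulgVK.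
Qed.

Lemma expgz_addn (G : groupType) (x : G) (r : int) (n : nat) :
  expgz x (r + n%:Z)%R = expgz x r * x ^+ n.
Proof.
elim: n => [|n IHn]; first by rewrite GRing.addr0 mulg1.
by rewrite -addn1 PoszD GRing.addrA expgz_succ IHn addn1 expgSr mulgA.
Qed.

Lemma expgz1 (G : groupType) (r : int) : expgz (1 : G) r = 1.
Proof. by case: r => n /=; rewrite expg1n ?invg1. Qed.

Lemma commute_expgz (G : groupType) (x : G) (r : int) : commute x (expgz x r).
Proof.
case: r => n /=; first exact/commuteX/commute_refl.
exact/commuteV/commuteX/commute_refl.
Qed.

Lemma bounded_nat_max (Q : nat -> Prop) (N : nat) :
  Q 0 -> (forall n, Q n -> (n <= N)%N) ->
  exists2 n, Q n & forall k, Q k -> (k <= n)%N.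
Proof.
move=> Q0; elim: N => [|N IHN] boundQ; first by exists 0.
have [QN | nQN] := classic (Q N.+1); first by exists N.+1.
apply: IHN => n Qn; have := boundQ n Qn.
by rewrite leq_eqVlt => /predU1P[n_eq | //]; rewrite n_eq in Qn.
Qed.

(** * Length of factorizations into atoms *)

Section Length.
Variables (M : monoidType) (gaussM : gaussian M).
Implicit Types (x y z t : M) (n : nat).

Definition length_le x n : Prop :=
  forall s : seq M, (forall y, y \in s -> atom y) ->
    x = \prod_(y <- s) y -> (size s <= n)%N.

Lemma length_bounded x : exists n, length_le x n.
Proof.
by have [_ bounded] := gaussian_atomic gaussM; have [n _ ?] := bounded x; exists n.
Qed.

Lemma length_le0 x : length_le x 0 -> x = 1.
Proof.
have [gen _] := gaussian_atomic gaussM; have [s atoms_s x_s] := gen x.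
by move=> /(_ s atoms_s x_s); rewrite leqn0 x_s => /nilP->; rewrite big_nil.
Qed.

(** Factorizations of y and z concatenate into one of y * z, and a nontrivial y
    contributes at least one atom to it. *)
Lemma length_leMr y z n : y <> 1 -> length_le (y * z) n ->
  (0 < n)%N /\ length_le z n.-1.
Proof.
move=> y_neq1 len_yz; have [gen _] := gaussian_atomic gaussM.
have [sy atoms_sy y_sy] := gen y.
have sy_gt0 : (0 < size sy)%N.
  by case: sy y_sy {atoms_sy} => // /[!big_nil].
have key (s : seq M) : (forall t, t \in s -> atom t) -> z = \prod_(t <- s) t ->
    (size sy + size s <= n)%N.
  move=> atoms_s z_s; rewrite -size_cat; apply: len_yz.
    by move=> t; rewrite mem_cat => /orP[/atoms_sy | /atoms_s].
  by rewrite big_cat -y_sy -z_s.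
split=> [|s atoms_s /(key s atoms_s)]; last by lia.
by have [sz atoms_sz z_sz] := gen z; have := key sz atoms_sz z_sz; lia.
Qed.

Lemma length_leMl y z n : z <> 1 -> length_le (y * z) n ->
  (0 < n)%N /\ length_le y n.-1.
Proof.
move=> z_neq1 len_yz; have [gen _] := gaussian_atomic gaussM.
have [sz atoms_sz z_sz] := gen z.
have sz_gt0 : (0 < size sz)%N.
  by case: sz z_sz {atoms_sz} => // /[!big_nil].
have key (s : seq M) : (forall t, t \in s -> atom t) -> y = \prod_(t <- s) t ->
    (size s + size sz <= n)%N.
  move=> atoms_s y_s; rewrite -size_cat; apply: len_yz.
    by move=> t; rewrite mem_cat => /orP[/atoms_s | /atoms_sz].
  by rewrite big_cat -y_s -z_sz.
split=> [|s atoms_s /(key s atoms_s)]; last by lia.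
by have [sy atoms_sy y_sy] := gen y; have := key sy atoms_sy y_sy; lia.
Qed.

Lemma length_leX y z n k : y <> 1 -> length_le (y ^+ k * z) n -> (k <= n)%N.
Proof.
move=> y_neq1; elim: k n => // k IHk n; rewrite expgS -mulgA.
by move=> /(length_leMr y_neq1)[n_gt0 /IHk]; lia.
Qed.

(** Proper left divisors are shorter, so left divisibility is well founded. *)
Lemma minimal_ldivisor (Q : M -> Prop) x : x <> 1 -> Q x ->
  exists t, [/\ ldivides t x, t <> 1, Q t &
    forall r, r <> 1 -> Q r -> ldivides r t -> r = t].
Proof.
have [n] := length_bounded x.
elim: n x => [|n IHn] x len_x x_neq1 Qx; first by case: (x_neq1 (length_le0 len_x)).
have [[r [r_neq1 [Qr [[c rc_x] r_neqx]]]] | no_r] := classic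
    (exists r, r <> 1 /\ Q r /\ ldivides r x /\ r <> x).
- have c_neq1 : c <> 1 by move=> c1; apply: r_neqx; rewrite -rc_x c1 mulg1.
  have [|_ len_r] := @length_leMl r c n.+1 c_neq1; first by rewrite rc_x.
  have [t [[d td_r] t_neq1 Qt min_t]] := IHn r len_r r_neq1 Qr.
  by exists t; split=> //; exists (d * c); rewrite mulgA td_r.
exists x; split=> // [|r r_neq1 Qr r_x]; first by exists 1; rewrite mulg1.
by apply: NNPP => r_neqx; apply: no_r; exists r.
Qed.

Lemma ldivides_trans x y z : ldivides x y -> ldivides y z -> ldivides x z.
Proof. by move=> [c <-] [d <-]; exists (c * d); rewrite mulgA. Qed.

(** Left gcds commute with left multiplication; only the divisibility that
    results from it is recorded. *)
Lemma ldivides_mul_gcd w x y d t : is_gcd (@ldivides M) x y d ->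
  ldivides t (w * x) -> ldivides t (w * y) -> ldivides t (w * d).
Proof.
move=> [_ _ max_d] t_wx t_wy.
have [g [[cx g_wx] [cy g_wy] max_g]] := gaussian_lgcd gaussM (w * x) (w * y).
have [h wh_g] : ldivides w g by apply: max_g; [exists x | exists y].
apply: (ldivides_trans (max_g t t_wx t_wy)).
have [c hc_d] : ldivides h d.
  by apply: max_d; [exists cx | exists cy];
    apply: (gaussian_cancell gaussM (a := w)); rewrite mulgA wh_g.
by exists c; rewrite -wh_g -mulgA hc_d.
Qed.

End Length.

(** * Conjugation by the Garside element *)

Section Garside.
Variables (M : monoidType) (Delta : M) (G : groupType).
Variables (iota : UMagmaMorphism.type M G).
Hypotheses (garsideM : garside_monoid Delta) (fracG : group_of_fractions iota).
Implicit Types (x y z s t d : M) (g h u v a : G) (n k : nat) (m r : int).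

Let gaussM : gaussian M := garsideM.1.
Let garsideD : garside_element Delta := garsideM.2.
Let iota_inj : injective iota := fracG.1.
Local Notation D := (iota Delta).
Local Notation inM := (in_monoid iota).

Lemma simple_induction (P : M -> Prop) :
  P 1 -> (forall s x, simple Delta s -> P x -> P (s * x)) -> forall x, P x.
Proof.
move=> P1 PM x; have [l simple_l ->] := garside_generates garsideD x.
elim: l simple_l => [|s l IHl] simple_l; first by rewrite big_nil.
rewrite big_cons; apply: PM; first by apply: simple_l; rewrite mem_head.
by apply: IHl => y y_l; apply: simple_l; rewrite in_cons y_l orbT.
Qed.

Lemma nontrivial_simple_ldivisor x : x <> 1 ->
  exists s, [/\ simple Delta s, s <> 1 & ldivides s x].
Proof.
elim/simple_induction: x => // s x simple_s IHx.
have [-> | /eqP s_neq1 _] := eqVneq s 1; first by rewrite mul1g.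
by exists s; split=> //; exists x.
Qed.

Lemma in_monoidM g h : inM g -> inM h -> inM (g * h).
Proof. by move=> [x ->] [y ->]; exists (x * y); rewrite gmulfM. Qed.

Lemma ldividesE x y : ldivides x y <-> inM ((iota x)^-1 * iota y).
Proof.
split=> [[c <-] | [c xy_c]]; first by exists c; rewrite gmulfM mulKg.
by exists c; apply: iota_inj; rewrite gmulfM -xy_c mulVKg.
Qed.

Definition stabilizes_monoid h : Prop := forall g, inM g -> inM (g ^ h).

Lemma stabilizes_monoid_simple h :
  (forall s, simple Delta s -> inM (iota s ^ h)) -> stabilizes_monoid h.
Proof.
move=> stab_s _ [x ->]; elim/simple_induction: x => [|s x simple_s IHx].
  by rewrite gmulf1 conj1g; exists 1; rewrite gmulf1.
by rewrite gmulfM conjMg; apply: in_monoidM => //; apply: stab_s.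
Qed.

(** If s s' = Delta then s' is simple too, so s' s'' = Delta for some s'', and
    s Delta = s s' s'' = Delta s''. *)
Lemma simple_conj_Delta s : simple Delta s ->
  exists2 t, simple Delta t & iota s ^ D = iota t.
Proof.
move=> [s' ss']; have [t s't] : ldivides s' Delta.
  by apply/(garside_divisors garsideD); exists s.
exists t; first by apply/(garside_divisors garsideD); exists s'.
by rewrite conjgE -!gmulfM -{2}s't mulgA ss' gmulfM mulKg.
Qed.

Lemma stabilizes_monoid_Delta : stabilizes_monoid D.
Proof.
by apply: stabilizes_monoid_simple => s /simple_conj_Delta[t _ ->]; exists t.
Qed.

Lemma stabilizes_monoid_DeltaV : stabilizes_monoid D^-1.
Proof.
apply: stabilizes_monoid_simple => s /(garside_divisors garsideD)[c cs].
have /(garside_divisors garsideD)[t tc] : ldivides c Delta by exists s.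
by exists t; rewrite conjgE invgK -{1}tc mulgA -gmulfM -mulgA cs gmulfM mulgK.
Qed.

Lemma stabilizes_monoidX h n : stabilizes_monoid h -> stabilizes_monoid (h ^+ n).
Proof.
move=> stab_h; elim: n => [|n IHn] g gM; first by rewrite conjg1.
by rewrite expgSr conjgM; apply/stab_h/IHn.
Qed.

Lemma stabilizes_monoid_expgz r : stabilizes_monoid (expgz D r).
Proof.
case: r => n /=; first exact/stabilizes_monoidX/stabilizes_monoid_Delta.
rewrite -expVgn; exact/stabilizes_monoidX/stabilizes_monoid_DeltaV.
Qed.

(** * A central power of the Garside element *)

(** The iterated conjugates of s by Delta stay in the finite set of simple
    elements, so two of the first N + 1 coincide, N being the length of a list
    containing all simple elements; the period of s then divides N!. *)
Lemma central_Delta_power : exists2 e, (0 < e)%N & forall g, commute (D ^+ e) g.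
Proof.
have [l simple_l] := garside_finite garsideD.
exists (size l)`!; first exact: fact_gt0.
set c := D ^+ _.
have comm_s s : simple Delta s -> commute (iota s) c.
  move=> simple_s.
  have orbit_s n : exists2 t, simple Delta t & iota s ^ (D ^+ n) = iota t.
    elim: n => [|n [t simple_t s_t]]; first by exists s; rewrite ?conjg1.
    by rewrite expgSr conjgM s_t; apply: simple_conj_Delta.
  pose orb := mkseq (fun n => iota s ^ (D ^+ n)) (size l).+1.
  have : ~~ uniq orb.
    apply/negP => uniq_orb.
    have sub_orb : {subset orb <= map iota l}.
      by move=> _ /mapP[n _ ->]; have [t /simple_l t_l ->] := orbit_s n;
        apply: map_f.
    have := uniq_leq_size uniq_orb sub_orb.
    by rewrite size_mkseq size_map ltnn.
  case/(uniqPn 1) => i [j [ij]]; rewrite size_mkseq => j_le.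
  rewrite !nth_mkseq ?(ltn_trans ij) // => conj_ij.
  have fix_s : iota s ^ (D ^+ (j - i)) = iota s.
    apply: (@conjg_inj _ (D ^+ i)).
    by rewrite -conjgM -expgnDr subnK ?(ltnW ij) // conj_ij.
  have comm_ji : commute (iota s) (D ^+ (j - i)).
    by rewrite /commute conjgC fix_s.
  have /dvdnP[q fact_q] : (j - i %| (size l)`!)%N by apply: dvdn_fact; lia.
  by rewrite /c fact_q mulnC expgnA; apply: commuteX.
have comm_M x : commute c (iota x).
  elim/simple_induction: x => [|s x /comm_s/commute_sym comm_cs IHx].
    by rewrite gmulf1; apply: commute1.
  by rewrite gmulfM; apply: commuteM.
by move=> g; have [x [y ->]] := fracG.2 g; apply/commuteM/commuteV.
Qed.

(** If s s' = Delta and x divides Delta^n then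
    (s x)^-1 Delta^(n+1) = (x^-1 Delta^n) (Delta^-n s' Delta^n). *)
Lemma Delta_power_multiple x : exists n, inM ((iota x)^-1 * D ^+ n).
Proof.
elim/simple_induction: x => [|s x [s' ss'] [n xM]].
  by exists 0; exists 1; rewrite gmulf1 invg1 mulg1.
exists n.+1.
have -> : (iota (s * x))^-1 * D ^+ n.+1 =
    (iota x)^-1 * D ^+ n * iota s' ^ (D ^+ n).
  by rewrite conjgE gmulfM -ss' gmulfM invgM expgS -!mulgA mulVKg mulKg.
apply: in_monoidM => //; apply: stabilizes_monoidX; last by exists s'.
exact: stabilizes_monoid_Delta.
Qed.

(** Multiplying an arbitrary conjugator by a large central power of Delta makes
    it an element of M without changing its action on u. *)
Lemma positive_conjugator u g : exists x, u ^ g = u ^ iota x.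
Proof.
have [e e_gt0 central_e] := central_Delta_power.
have [x [y ->]] := fracG.2 g; have [n yM] := Delta_power_multiple y.
have [z z_eq] : inM ((iota y)^-1 * D ^+ (n * e)).
  have -> : (n * e = n + n * e.-1)%N by case: e e_gt0 {central_e} => // e _; lia.
  rewrite expgnDr mulgA; apply: in_monoidM => //.
  by exists (Delta ^+ (n * e.-1)); rewrite gmulfXn.
exists (x * z); rewrite gmulfM -z_eq mulgA mulnC expgnA [RHS]conjgM.
apply/esym/conjg_fixP/commgP.
exact/commuteX/commute_sym/central_e.
Qed.

(** * Elements whose inf is at least m *)

(** Unlike a lower bound on inf(v), this membership makes sense before the
    maximum defining inf(v) is known to exist. *)
Definition inf_ge m v : Prop := inM ((expgz D m)^-1 * v).

(** If Delta = 1 then Delta^-r v does not depend on r, so the set of which inf(v)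
    is the maximum has no greatest element. *)
Lemma is_inf_Delta_neq1 v r : is_inf iota Delta v r -> Delta <> 1.
Proof.
move=> [v_r max_r] Delta1.
have : (r + 1 <= r)%R by apply: max_r; move: v_r; rewrite Delta1 gmulf1 !expgz1.
lia.
Qed.

Lemma is_inf_ge v r m : is_inf iota Delta v r -> (m <= r)%R -> inf_ge m v.
Proof.
move=> [[x v_x] _] m_le_r; exists (Delta ^+ `|r - m|%N * x).
have r_eq : (r = m + `|r - m|%N%:Z)%R by lia.
move: v_x; rewrite expgzN gmulfM gmulfXn {1}r_eq expgz_addn invgM -mulgA => <-.
by rewrite mulVKg.
Qed.

(** Delta^-(m+n) v lies in M only if Delta^n left-divides the element
    Delta^-m v of M, and then n is at most its length. *)
Lemma inf_exists v m : Delta <> 1 -> inf_ge m v ->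
  exists2 r, is_inf iota Delta v r & (m <= r)%R.
Proof.
move=> Delta_neq1 v_m; have [w v_w] := v_m.
have [N len_w] := length_bounded gaussM w.
pose Q n := inf_ge (m + n%:Z)%R v.
have Q0 : Q 0 by rewrite /Q GRing.addr0.
have [|n Qn max_n] := @bounded_nat_max Q N Q0.
  move=> n [x]; rewrite expgz_addn invgM -mulgA v_w => x_eq.
  apply: (length_leX (z := x) gaussM Delta_neq1).
  suff <- : w = Delta ^+ n * x by [].
  by apply: iota_inj; rewrite gmulfM gmulfXn -x_eq mulVKg.
exists (m + n%:Z)%R; last by lia.
split=> [|r']; first by rewrite expgzN.
rewrite expgzN => v_r'; have [r'_le | m_lt] := Order.TotalTheory.leP r' m.
  by lia.
have r'_eq : (r' = m + `|r' - m|%N%:Z)%R by lia.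
have : (`|r' - m| <= n)%N by apply: max_n; rewrite /Q -r'_eq.
lia.
Qed.

Lemma conj_class_geP a m v : Delta <> 1 ->
  conj_class_ge iota Delta a m v <-> conj_class a v /\ inf_ge m v.
Proof.
move=> Delta_neq1; split=> [[a_v [r inf_r m_r]] | [a_v v_m]].
  by split=> //; apply: is_inf_ge m_r.
by split=> //; apply: inf_exists.
Qed.

Lemma inf_ge_conj_Delta m u : inf_ge m u -> inf_ge m (u ^ D).
Proof.
move=> /stabilizes_monoid_Delta; rewrite /inf_ge conjMg conjVg.
suff -> : expgz D m ^ D = expgz D m by [].
exact/conjg_fixP/commgP/commute_sym/commute_expgz.
Qed.

(** In G, Delta^-m (u ^ x) = (Delta^-m x Delta^m)^-1 (Delta^-m u) x, so that a
    condition on u ^ x becomes a divisibility in M. *)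
Lemma inf_ge_conj_ldivides m u w x tx :
    iota w = (expgz D m)^-1 * u -> iota tx = iota x ^ expgz D m ->
  inf_ge m (u ^ iota x) <-> ldivides tx (w * x).
Proof.
move=> w_u tx_x; rewrite ldividesE gmulfM w_u tx_x /inf_ge.
suff -> : (expgz D m)^-1 * u ^ iota x =
    (iota x ^ expgz D m)^-1 * ((expgz D m)^-1 * u * iota x) by [].
by rewrite !conjgE !invgM invgK -!mulgA mulVKg.
Qed.

(** With t(z) = Delta^-m z Delta^m, which is multiplicative on M: t(d) divides
    t(x) and t(y), hence w x and w y, hence their gcd w d. *)
Lemma inf_ge_conj_gcd m u x y d : is_gcd (@ldivides M) x y d -> inf_ge m u ->
  inf_ge m (u ^ iota x) -> inf_ge m (u ^ iota y) -> inf_ge m (u ^ iota d).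
Proof.
move=> gcd_d [w /esym w_u].
have [[cx dcx] [cy dcy] _] := gcd_d.
have twist z : exists tz, iota tz = iota z ^ expgz D m.
  by have [|tz ->] := @stabilizes_monoid_expgz m (iota z); [exists z | exists tz].
have [[tx tx_x] [ty ty_y]] := (twist x, twist y).
have [td td_d] := twist d.
have [[tcx tcx_cx] [tcy tcy_cy]] := (twist cx, twist cy).
have td_tx : ldivides td tx.
  by exists tcx; apply: iota_inj; rewrite gmulfM td_d tcx_cx tx_x -conjMg -gmulfM dcx.
have td_ty : ldivides td ty.
  by exists tcy; apply: iota_inj; rewrite gmulfM td_d tcy_cy ty_y -conjMg -gmulfM dcy.
move=> /(inf_ge_conj_ldivides w_u tx_x) tx_wx /(inf_ge_conj_ldivides w_u ty_y) ty_wy.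
apply/(inf_ge_conj_ldivides w_u td_d)/(ldivides_mul_gcd gaussM gcd_d).
  exact: ldivides_trans tx_wx.
exact: ldivides_trans ty_wy.
Qed.

(** * Paths of minimal simple conjugations *)

Section Paths.
Variables (a : G) (m : int).
Hypothesis Delta_neq1 : Delta <> 1.
Local Notation Cge := (conj_class_ge iota Delta a m).

Lemma conj_class_ge_conj u h : Cge u -> inf_ge m (u ^ h) -> Cge (u ^ h).
Proof.
move=> /(conj_class_geP _ _ _ Delta_neq1)[[g ->] _] uh_m.
by apply/(conj_class_geP _ _ _ Delta_neq1); split=> //; exists (g * h); rewrite conjgM.
Qed.

(** The left gcd of x and Delta is a nontrivial simple element that keeps u in
    the class, since both x and Delta do; a minimal one lies below it. *)
Lemma minimal_simple_ldivisor u x : x <> 1 -> Cge u -> Cge (u ^ iota x) ->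
  exists2 s, minimal_simple_ge iota Delta a m u s & ldivides s x.
Proof.
move=> x_neq1 Cu Cux.
have [_ u_m] := (conj_class_geP a m u Delta_neq1).1 Cu.
have [_ ux_m] := (conj_class_geP a m _ Delta_neq1).1 Cux.
have [d gcd_d] := gaussian_lgcd gaussM x Delta.
have [d_x simple_d max_d] := gcd_d.
have d_neq1 : d <> 1.
  have [s [simple_s s_neq1 s_x]] := nontrivial_simple_ldivisor x_neq1.
  have [c sc_d] := max_d s s_x simple_s.
  move=> d1; rewrite d1 in sc_d.
  apply/s_neq1/(gaussian_conical gaussM sc_d).
  by apply: (gaussian_cancelr gaussM (a := c)); rewrite -mulgA sc_d mulg1 mul1g.
pose Q s := simple Delta s /\ prop_ge iota Delta a m u s.
have Qd : Q d.
  split=> //; apply: conj_class_ge_conj => //.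
  exact: inf_ge_conj_gcd gcd_d u_m ux_m (inf_ge_conj_Delta u_m).
have [s [s_d s_neq1 [simple_s prop_s] min_s]] :=
  minimal_ldivisor gaussM d_neq1 Qd.
exists s; last exact: ldivides_trans d_x.
by split=> // t simple_t t_neq1 prop_t; apply: min_s.
Qed.

(** Induction on the length of x: conjugating by a minimal simple left divisor s
    leaves the shorter conjugator s^-1 x. *)
Lemma positive_conjugator_path u x : Cge u -> Cge (u ^ iota x) ->
  exists (k : nat) (w : nat -> G),
    [/\ (1 <= k)%N, w 1%N = u, w k = u ^ iota x,
        forall i : nat, (1 <= i <= k)%N -> Cge (w i) &
        forall i : nat, (1 <= i < k)%N ->
          exists2 s : M, minimal_simple_ge iota Delta a m (w i) s &
                         w i.+1 = (iota s)^-1 * w i * iota s].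
Proof.
have [n] := length_bounded gaussM x.
elim: n u x => [|n IHn] u x len_x Cu Cux; have [x1 | /eqP x_neq1] := eqVneq x 1.
1,3: exists 1%N, (fun=> u); split=> //; last by lia.
1,2: by rewrite x1 gmulf1 conjg1.
  by case: x_neq1; apply: (length_le0 gaussM).
have [s min_s [y sy_x]] := minimal_simple_ldivisor x_neq1 Cu Cux.
have [simple_s s_neq1 Cus _] := min_s.
rewrite -sy_x in len_x.
have [_ len_y] := length_leMr gaussM s_neq1 len_x.
rewrite -sy_x gmulfM conjgM in Cux *.
have [k [w [k_gt0 w1 wk Cw step_w]]] := IHn _ y len_y Cus Cux.
exists k.+1, (fun i => if (i <= 1)%N then u else w i.-1); split=> //.
- by rewrite ltnNge k_gt0.
- by move=> i i_le; case: ifP => // i_gt1; apply: Cw; lia.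
move=> [|[|i]] // i_lt; first by exists s; rewrite //= w1 conjgE mulgA.
by apply: step_w; lia.
Qed.

End Paths.
End Garside.

Theorem proposition4p10 (M : monoidType) (Delta : M) (G : groupType)
    (iota : UMagmaMorphism.type M G)
    (garsideM : garside_monoid Delta) (fracG : group_of_fractions iota)
    (a : G) (m : int) (u v : G)
    (Cu : conj_class_ge iota Delta a m u)
    (Cv : conj_class_ge iota Delta a m v) :
  exists (k : nat) (w : nat -> G),
    [/\ (1 <= k)%N, w 1%N = u, w k = v,
        forall i : nat, (1 <= i <= k)%N -> conj_class_ge iota Delta a m (w i) &
        forall i : nat, (1 <= i < k)%N ->
          exists2 s : M, minimal_simple_ge iota Delta a m (w i) s &
                         w i.+1 = (iota s)^-1 * w i * iota s].
Proof.
have [_ [r inf_u _]] := Cu; have Delta_neq1 := is_inf_Delta_neq1 inf_u.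
have [[g u_g] _] := Cu; have [[h v_h] _] := Cv.
have v_u : v = u ^ (g^-1 * h) by rewrite u_g v_h conjgM conjgK.
have [x x_gh] := positive_conjugator garsideM fracG u (g^-1 * h).
rewrite v_u x_gh in Cv *.
exact: positive_conjugator_path.
Qed.
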